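(* Let $n_1,n_2,n_3,n_4\ge 2$ be integers and $a_i=n_i-1$ for $i\in[4]$. Then \[ m_0(1,n_1,n_2,n_3,n_4)=1+\sum_{i=1}^4a_i+\max_{G\in\mathcal I_4}\sum_{ij\in E(G)}a_ia_j . \] In particular, if $n_1\ge n_2\ge n_3\ge n_4$, then \[ m_0(1,n_1,n_2,n_3,n_4)=\max\bigl\{\,n_1(n_2+n_3+n_4-2),\ \ n_1n_2n_3-(n_1-1)(n_2-1)(n_3-1)+n_4-1\,\bigr\}. \] Equivalently, under the ordering $n_1\ge n_2\ge n_3\ge n_4$, the maximum over $G\in\mathcal I_4$ in the first formula is attained either by the star centered at $1$ (edges $12,13,14$) or by the triangle on $\{1,2,3\}$ (edges $12,13,23$).
   Context: Write $[r]=\{1,\ldots,r\}$. Let $X_1,\ldots,X_r$ be finite sets with $|X_i|=n_i$. A family $\mathcal F\subseteq X_1\times\cdots\times X_r$ is viewed as an $r$-partite $r$-graph with (disjoint) parts $X_1,\ldots,X_r$: a tuple $(x_1,\ldots,x_r)$ is the edge whose vertices are $x_1\in X_1,\ldots,x_r\in X_r$, so two tuples $\mathbf x,\mathbf y$ are disjoint edges if and only if $x_i\ne y_i$ for all $i\in[r]$. Let $\nu(\mathcal F)$ be the maximum number of pairwise disjoint edges in $\mathcal F$, and $\tau(\mathcal F)$ the minimum size of a vertex set meeting every edge of $\mathcal F$. The number $m_0(1,n_1,\ldots,n_r)$ is the maximum size of a family $\mathcal F\subseteq X_1\times\cdots\times X_r$ satisfying $\nu(\mathcal F)\le 1<\tau(\mathcal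 F)$; equivalently, any two members of $\mathcal F$ agree in at least one coordinate, and no vertex is common to all members of $\mathcal F$. Here $r=4$. An intersecting graph is a (simple) graph in which every pair of edges shares a common vertex. $\mathcal I_4$ denotes the set of all intersecting graphs on vertex set $[4]$, including the empty graph. *)

(* Defs.v *)
From mathcomp Require Import all_boot.

Set Implicit Arguments.
Unset Strict Implicit.
Unset Printing Implicit Defensive.

Section PartiteHypergraph.

Variables (r : nat) (X : 'I_r -> finType).

Definition vertex := {i : 'I_r & X i}.

Definition edge := {dffun forall i : 'I_r, X i}.

Definition vertices (x : edge) : {set vertex} :=
  [set Tagged (fun i => X i : Type) (x i) | i : 'I_r].

Definition matching (M : {set edge}) : bool :=
  [forall x in M, forall y in M,
     (x != y) ==> [disjoint vertices x & vertices y]].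

Definition nu (F : {set edge}) : nat :=
  \max_(M : {set edge} | (M \subset F) && matching M) #|M|.

Definition vertex_cover (F : {set edge}) (T : {set vertex}) : bool :=
  [forall x in F, vertices x :&: T != set0].

(* For r > 0 the set of all vertices covers every family, so the minimum is
   over a nonempty collection. *)
Definition tau (F : {set edge}) : nat :=
  #|[arg min_(T < [set: vertex] | vertex_cover F T) #|T|]|.

(* The value is 0 when no family satisfies the constraint. *)
Definition m0 (s : nat) : nat :=
  \max_(F : {set edge} | nu F <= s < tau F) #|F|.

End PartiteHypergraph.

(* A graph is given by its edge set E, a set of 2-element sets of vertices. *)
Definition simple_graph (V : finType) (E : {set {set V}}) : bool :=
  [forall e in E, #|e| == 2].

Definition intersecting_graph (V : finType) (E : {set {set V}}) : bool :=
  simple_graph E && [forall e in E, forall f in E, e :&: f != set0].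

(* Each edge ij is counted once, as the pair with i < j. *)
Definition weight (k : nat) (a : 'I_k -> nat) (E : {set {set 'I_k}}) : nat :=
  \sum_(i < k) \sum_(j < k | (i < j) && ([set i; j] \in E)) a i * a j.

Definition max_attained_at (k : nat) (a : 'I_k -> nat) (G : {set {set 'I_k}}) :
    Prop :=
  intersecting_graph G /\
  weight a G = \max_(E : {set {set 'I_k}} | intersecting_graph E) weight a E.

(* The elements 1, 2, 3, 4 of [4], which is represented by 'I_4 = {0,1,2,3}. *)
Definition i1 : 'I_4 := @Ordinal 4 0 isT.
Definition i2 : 'I_4 := @Ordinal 4 1 isT.
Definition i3 : 'I_4 := @Ordinal 4 2 isT.
Definition i4 : 'I_4 := @Ordinal 4 3 isT.

Definition star1 : {set {set 'I_4}} :=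
  [set [set i1; i2]; [set i1; i3]; [set i1; i4]].

Definition triangle123 : {set {set 'I_4}} :=
  [set [set i1; i2]; [set i1; i3]; [set i2; i3]].

(* Main.v *)
Require Import Defs.
From mathcomp Require Import all_boot.
From mathcomp Require Import zify.

(** Proof idea. Fix a base edge [x0]; the extremal families consist of the edges
    that differ from [x0] in at most one coordinate, or exactly in the two ends of
    an edge of an intersecting graph. For the upper bound, replace a value of a
    coordinate by its base value wherever the result is not yet in the family.
    This preserves size and the intersection property. If no common vertex ever
    appears, any two edges of the compressed family agree at a base value, so the
    sets of coordinates where they leave [x0] never cover [4], which gives the
    bound directly. If a push in direction [i] would create a common vertex, then
    coordinate [i] takes only two values and the two slices are disjoint; freeze
    [i] and compress the other coordinates. Either this succeeds, and coordinate
    [i] counts as a part of size 2, or a second coordinate [j] is split and the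
    family consists of four subsets of a two-dimensional grid, where opposite ones
    are cross-intersecting and those differing only in [j] are disjoint. *)

Set Implicit Arguments.
Unset Strict Implicit.
Unset Printing Implicit Defensive.

(** * Intersecting families and compression *)

Section Families.

Variables (r : nat) (X : 'I_r -> finType).
Implicit Types (x y : edge X) (F : {set edge X}) (i j : 'I_r).

Definition pairwise_agree F : Prop :=
  forall x y, x \in F -> y \in F -> exists i, x i = y i.

Definition no_common_vertex F : Prop :=
  forall i (c : X i), exists2 x, x \in F & x i != c.

Lemma mem_vertices x i (c : X i) :
  (Tagged (fun i => X i : Type) c \in vertices x) = (x i == c).
Proof.
apply/imsetP/eqP => [[j _ e]|<-]; last by exists i.
have e1 : i = j := congr1 tag e; subst j.
by have /eqP := e; rewrite eq_Tagged /= => /eqP.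
Qed.

Lemma meet_vertices x y :
  reflect (exists i, x i = y i) (~~ [disjoint vertices x & vertices y]).
Proof.
apply: (iffP pred0Pn) => [[[i c] /= /andP[]]|[i e]].
  by rewrite !mem_vertices => /eqP <- /eqP e; exists i.
by exists (Tagged (fun i => X i : Type) (x i)); rewrite /= !mem_vertices e eqxx.
Qed.

Lemma nu_le1P F : 0 < r -> reflect (pairwise_agree F) (nu F <= 1).
Proof.
move=> r_gt0; apply: (iffP idP) => [nuF x y xF yF|agF].
  have [<-|neq_xy] := eqVneq x y; first by exists (Ordinal r_gt0).
  apply/meet_vertices/negP => disj_xy.
  suff : 1 < nu F by rewrite ltnNge nuF.
  rewrite -[2](_ : #|[set x; y]| = 2); last by rewrite cards2 neq_xy.
  apply: leq_bigmax_cond; apply/andP; split.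
    by apply/subsetP => z /set2P[] ->.
  apply/forall_inP => u /set2P[] ->; apply/forall_inP => v /set2P[] ->;
    by rewrite ?eqxx // disj_xy implybT || rewrite disjoint_sym disj_xy implybT.
apply/bigmax_leqP => M /andP[/subsetP MF /forall_inP mM].
rewrite leqNgt; apply/negP => /card_gt1P[x [y [xM yM neq_xy]]].
have /forall_inP/(_ _ yM) := mM _ xM; rewrite neq_xy /=.
by apply/negP/meet_vertices; apply: agF; apply: MF.
Qed.

Lemma tau_gt1P F :
  0 < r -> (forall i, 0 < #|X i|) -> reflect (no_common_vertex F) (1 < tau F).
Proof.
(* The minimum ranges over covers with the full vertex set as default, so that set must first be
   shown to cover [F]. *)
move=> r_gt0 X_gt0; rewrite /tau; case: arg_minnP => [|T /forall_inP coverT minT].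
  apply/forall_inP => x _; rewrite setIT; apply/set0Pn.
  by exists (Tagged (fun i => X i : Type) (x (Ordinal r_gt0))); rewrite mem_vertices.
apply: (iffP idP) => [T_gt1 i c|ncF].
  case: (pickP [pred x in F | x i != c]) => [x /andP[xF xi]|no]; first by exists x.
  suff /minT : vertex_cover F [set Tagged (fun i => X i : Type) c].
    by rewrite cards1 leqNgt T_gt1.
  apply/forall_inP => x xF; apply/set0Pn.
  exists (Tagged (fun i => X i : Type) c); rewrite inE mem_vertices set11 andbT.
  by have := no x; rewrite /= xF /= => /negbFE.
rewrite ltnNge; apply/negP => T_le1.
(* Some edge meets [T] at a vertex [(i, c)]; an edge avoiding this vertex meets [T] elsewhere, so
   [T] has two elements. *)
have [c0 _] := card_gt0P (X_gt0 (Ordinal r_gt0)).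
have [x xF _] := ncF _ c0.
have /set0Pn[[i c] /setIP[_ icT]] := coverT _ xF.
have [y yF] := ncF _ c; have /set0Pn[v /setIP[vy vT]] := coverT _ yF.
have /card_le1_eqP/(_ _ _ vT icT) e := T_le1.
by rewrite -e mem_vertices in vy; rewrite vy.
Qed.

End Families.

Section Compression.

Variables (r : nat) (X : 'I_r -> finType) (x0 : edge X).
Implicit Types (x y : edge X) (F : {set edge X}) (i j : 'I_r) (D : {set 'I_r}).

Definition supp x : {set 'I_r} := [set i | x i != x0 i].

Definition reset D x : edge X :=
  finfun (fun i => if i \in D then x0 i else x i).

Lemma resetE D x i : reset D x i = if i \in D then x0 i else x i.
Proof. exact: ffunE. Qed.

(** The shifting operator of extremal set theory; staying put when the target is occupied keeps it
    injective on [F]. *)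
Definition push F i (c : X i) x : edge X :=
  if (x i == c) && (reset [set i] x \notin F) then reset [set i] x else x.

Lemma push_neq F i (c : X i) x j : j != i -> push F c x j = x j.
Proof. by move=> ne; rewrite /push; case: ifP => //; rewrite resetE inE (negPf ne). Qed.

Lemma reset1_inj i x y : x i = y i -> reset [set i] x = reset [set i] y -> x = y.
Proof.
move=> e /ffunP eq_xy; apply/ffunP => j.
have := eq_xy j; rewrite !resetE inE; by case: eqP => // ->.
Qed.

Lemma push_inj F i (c : X i) : {in F &, injective (push F c)}.
Proof.
move=> x y xF yF; rewrite /push.
case: ifP => [/andP[/eqP ex nx]|_]; case: ifP => [/andP[/eqP ey ny]|_] //.
- by apply: reset1_inj; rewrite ex.
- by move=> e; rewrite e yF in nx.
- by move=> e; rewrite -e xF in ny.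
Qed.

Lemma card_push F i (c : X i) : #|push F c @: F| = #|F|.
Proof. exact/card_in_imset/push_inj. Qed.

Lemma push_agree F i (c : X i) : pairwise_agree F -> pairwise_agree (push F c @: F).
Proof.
move=> agF.
(* The mixed case: [x] moves and [y] stays. If [y i] is [c], then [y] stays because its reset is in
   [F], and [x] agrees with that reset away from [i]; otherwise [x] and [y] already agree away from
   [i]. *)
have half x y : x \in F -> y \in F -> push F c x <> x -> push F c y = y ->
    exists j, push F c x j = y j.
  move=> xF yF; rewrite {1 3}/push; case: ifP => // /andP[/eqP xc nx] _ ey.
  case: (eqVneq (y i) c) => [yc|ync]; last first.
    have [j exy] := agF _ _ xF yF; exists j; rewrite resetE inE.
    by case: eqP => // eji; subst j; rewrite -exy xc eqxx in ync.
  have ryF : reset [set i] y \in F.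
    move: ey; rewrite /push yc eqxx /=; case: ifP => [nryF ey|/negbFE //].
    by rewrite ey yF in nryF.
  have [j] := agF _ _ xF ryF; rewrite resetE inE.
  case: eqP => [->|nji] e; last by exists j; rewrite resetE inE; case: eqP.
  have rx : reset [set i] x = x.
    by apply/ffunP => k; rewrite resetE inE; case: eqP => // ->.
  by rewrite rx xF in nx.
move=> _ _ /imsetP[x xF ->] /imsetP[y yF ->].
have [ex|/eqP nx] := eqVneq (push F c x) x; have [ey|/eqP ny] := eqVneq (push F c y) y.
- by rewrite ex ey; apply: agF.
- by have [j e] := half _ _ yF xF ny ex; exists j; rewrite ex e.
- by rewrite ey; apply: half.
- exists i; move: nx ny; rewrite /push.
  by do 2!case: ifP => // _; rewrite !resetE set11.
Qed.

Lemma supp_reset D x : supp (reset D x) = supp x :\: D.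
Proof.
by apply/setP => i; rewrite !inE resetE; case: (i \in D); rewrite ?eqxx.
Qed.

Lemma push_supp F i (c : X i) :
    (exists2 x, x \in F & push F c x != x) ->
  \sum_(x in push F c @: F) #|supp x| < \sum_(x in F) #|supp x|.
Proof.
case=> x xF nx; rewrite big_imset /=; last exact: push_inj.
have le y : #|supp (push F c y)| <= #|supp y|.
  rewrite /push; case: ifP => // _.
  by rewrite supp_reset subset_leq_card // subsetDl.
rewrite (bigD1 x) //= [ltnRHS](bigD1 x) //= -addSn leq_add ?leq_sum //.
move: nx; rewrite /push; case: ifP => [_|]; last by rewrite eqxx.
rewrite supp_reset => nx.
suff xi : i \in supp x by rewrite [in ltnRHS](cardsD1 i) xi.
rewrite inE; apply: contraNneq nx => xi.
by apply/eqP/ffunP => k; rewrite resetE inE; case: eqP => // ->.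
Qed.

(** The second clause makes the slices at [c] and at the base value disjoint after coordinate [i] is
    deleted. *)
Definition split_at F i (c : X i) : Prop :=
  forall x, x \in F -> x i = x0 i \/ x i = c /\ reset [set i] x \notin F.

(** Other coordinates do not change, and some edge reaches the base value at [i]. Hence only [x0 i]
    can become common, and then every edge either has this value already or is moved to it. *)
Lemma push_common F i (c : X i) :
    no_common_vertex F -> (exists2 x, x \in F & push F c x != x) ->
  no_common_vertex (push F c @: F) \/ split_at F c.
Proof.
move=> ncF [x xF nx].
case: (boolP [forall y in F, push F c y i == x0 i]) => [/forall_inP all0|].
  right=> y yF; have /eqP := all0 y yF; rewrite /push.
  by case: ifP => [/andP[/eqP -> ->]|_ ->]; [right | left].
rewrite negb_forall_in => /exists_inP[y yF ny]; left=> j d.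
have [eji|nji] := eqVneq j i; last first.
  have [z zF nz] := ncF j d; exists (push F c z); first exact: imset_f.
  by rewrite push_neq.
subst j; have [ed|nd] := eqVneq d (x0 i).
  by exists (push F c y); [exact: imset_f | rewrite ed].
exists (push F c x); first exact: imset_f.
move: nx; rewrite /push; case: ifP => [_ _|]; last by rewrite eqxx.
by rewrite resetE set11 eq_sym.
Qed.

(** Boxes keep a frozen coordinate two-valued while the others are compressed. *)
Lemma push_box F i (c : X i) (B : forall i, {set X i}) :
  x0 \in setXn B -> F \subset setXn B -> push F c @: F \subset setXn B.
Proof.
move=> /setXnP x0B /subsetP FB; apply/subsetP => _ /imsetP[x xF ->].
have /setXnP xB := FB _ xF; apply/setXnP => j.
by rewrite /push; case: ifP => // _; rewrite resetE; case: ifP.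
Qed.

Definition stable D F : Prop :=
  forall x i, x \in F -> i \notin D -> reset [set i] x \in F.

(* Pushing values outside [D] down to [x0] terminates because the total support
   decreases; it can only fail by creating a common vertex, and then the family
   is split. *)
Lemma compress D (B : forall i, {set X i}) F :
    x0 \in setXn B -> F \subset setXn B -> pairwise_agree F -> no_common_vertex F ->
  exists F', [/\ #|F'| = #|F|, F' \subset setXn B, pairwise_agree F',
    no_common_vertex F' &
    stable D F' \/ exists i, i \notin D /\ exists c : X i, split_at F' c].
Proof.
move=> x0B; have [m] := ubnP (\sum_(x in F) #|supp x|).
elim: m => // m IHm in F * => lt_m FB agF ncF.
case: (boolP [exists x in F, exists i in ~: D, reset [set i] x \notin F]); last first.
  rewrite negb_exists_in => /forall_inP stF; exists F; split=> //; left=> x i xF iD.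
  have := stF x xF; rewrite negb_exists_in => /forall_inP/(_ i).
  by rewrite inE iD negbK; apply.
case/exists_inP => x xF /exists_inP[i]; rewrite inE => iD nrx.
have moved : exists2 y, y \in F & push F (x i) y != y.
  exists x => //; rewrite /push eqxx nrx /=.
  by apply: contraNneq nrx => ->.
case: (push_common ncF moved) => [ncF'|spF]; last first.
  by exists F; split=> //; right; exists i; split=> //; exists (x i).
have := push_supp moved; case/leq_trans/(_ (ltnSE lt_m))/IHm => //.
- exact: push_box.
- exact: push_agree.
by move=> F'; rewrite card_push; exists F'.
Qed.

Lemma stable_reset D (E : {set 'I_r}) F x :
  stable D F -> x \in F -> [disjoint E & D] -> reset E x \in F.
Proof.
move=> stF xF; have [m] := ubnP #|E|; elim: m => // m IHm in E *.
have [->|[i iE]] := set_0Vmem E.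
  move=> _ _; suff -> : reset set0 x = x by [].
  by apply/ffunP => i; rewrite resetE inE.
rewrite (cardsD1 i) iE => /ltnSE lt_m disED.
have -> : reset E x = reset [set i] (reset (E :\ i) x).
  by apply/ffunP => j; rewrite !resetE !inE; case: eqP => // ->; rewrite iE.
apply: stF; last by rewrite (disjointFr disED).
apply: IHm => //; apply: disjointWl disED; exact: subsetDl.
Qed.

(* Resetting in one edge all the coordinates where it agrees with the other at a
   value different from [x0] leaves only agreements at [x0]. *)
Lemma stable_agree D F x y :
    stable D F -> pairwise_agree F -> x \in F -> y \in F ->
    (forall i, i \in D -> x i != y i) ->
  supp x :|: supp y != setT.
Proof.
move=> stF agF xF yF neD.
pose E := [set i | (x i == y i) && (x i != x0 i)].
(* [E] contains no frozen coordinate, because [x] and [y] differ on [D]. *)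
have ryF : reset E y \in F.
  apply: (stable_reset stF yF); rewrite disjoint_subset; apply/subsetP => i.
  by rewrite !inE => /andP[e _]; apply: contraL e => /neD.
have [i] := agF _ _ xF ryF; rewrite resetE inE => e.
apply/eqP => /setP/(_ i); rewrite !inE; move: e.
case: ifP => [/andP[_ n] e|]; first by rewrite e eqxx in n.
by move=> + e; rewrite e eqxx /=; case: eqP.
Qed.

(** The fibre is itself a box: non-base values on [S], the base value elsewhere. *)
Lemma card_supp_fibre (B : forall i, {set X i}) (S : {set 'I_r}) :
    x0 \in setXn B ->
  #|[set x in setXn B | supp x == S]| = \prod_(i in S) #|B i|.-1.
Proof.
move=> /setXnP x0B.
have -> : [set x in setXn B | supp x == S] =
    setXn (fun i => if i \in S then B i :\ x0 i else [set x0 i]).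
  apply/setP => x; rewrite inE; apply/andP/setXnP => [[/setXnP xB /eqP <-] i|xS].
    by rewrite inE; case: eqVneq => [->|]; rewrite !inE ?eqxx //= => ->; rewrite xB.
  split.
    by apply/setXnP => i; have := xS i; case: ifP; rewrite !inE => _; [case/andP | move/eqP->].
  apply/eqP/setP => i; have := xS i; rewrite inE.
  by case: ifP; rewrite !inE => _; [case/andP | move/eqP->; rewrite eqxx].
rewrite cardsXn [RHS]big_mkcond /=; apply: eq_bigr => i _.
by case: ifP => _; rewrite ?cards1 // (cardsD1 (x0 i) (B i)) x0B.
Qed.

End Compression.

(** * Weights of graphs *)

Section Weights.

Variable k : nat.
Implicit Types (a b : 'I_k -> nat) (E S T : {set {set 'I_k}}).

Lemma weightE a E :
  simple_graph E -> weight a E = \sum_(e in E) \prod_(i in e) a i.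
Proof.
move=> /forall_inP simE.
rewrite /weight pair_big_dep /=.
pose h (p : 'I_k * 'I_k) := [set p.1; p.2].
pose A := [set p : 'I_k * 'I_k | (p.1 < p.2) && (h p \in E)].
have h_inj : {in A &, injective h}.
  move=> [i j] [i' j']; rewrite !inE /h /= => /andP[lt _] /andP[lt' _] /setP e.
  have /esym := e i; have /esym := e j; have := e i'; have := e j'.
  rewrite !inE !eqxx ?orbT /= -!val_eqE /= => e1 e2 e3 e4.
  by congr pair; apply: val_inj => /=; lia.
have eqE : E = h @: A.
  apply/setP => e; apply/idP/imsetP => [eE|[p]]; last by rewrite inE => /andP[_ pE] ->.
  have /cards2P[i [j [nij ee]]] := simE _ eE; subst e.
  case: (ltngtP i j) => [lt|lt|/val_inj eij]; last by rewrite eij eqxx in nij.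
    by exists (i, j); rewrite // inE lt.
  by exists (j, i); [rewrite inE /h /= lt setUC | rewrite /h /= setUC].
transitivity (\sum_(e in h @: A) \prod_(i in e) a i); last by rewrite -eqE.
rewrite big_imset //=; apply: eq_big => [p|p /andP[lt _]]; first by rewrite inE.
rewrite /h big_setU1 ?big_set1 // inE; apply: contraTneq lt => ->.
by rewrite ltnn.
Qed.

(** With [a i + 1] values at each coordinate [i], this counts the edges whose support has at most
    one element or lies in [E]. *)
Definition ball_weight a E : nat :=
  \sum_(e : {set 'I_k} | (#|e| <= 1) || (e \in E)) \prod_(i in e) a i.

Lemma ball_weightE a E :
  simple_graph E -> ball_weight a E = 1 + \sum_i a i + weight a E.
Proof.
move=> simE; rewrite weightE // /ball_weight (bigID (fun e => e \in E)) /= addnC.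
congr addn; last first.
  apply: eq_bigl => e; case: (boolP (e \in E)); rewrite ?andbF // orbT //.
rewrite (bigD1 set0) /=; last first.
  rewrite cards0; apply/negP => /(forall_inP simE).
  by rewrite cards0.
rewrite big_set0; congr addn.
have -> : \sum_i a i = \sum_(e in [set [set i] | i : 'I_k]) \prod_(i in e) a i.
  rewrite big_imset /=; last by move=> i j _ _; apply: set1_inj.
  by apply: eq_big => // i _; rewrite big_set1.
apply: eq_bigl => e; apply/andP/imsetP => [[/andP[+ nE] n0]|[i _ ->]].
  rewrite (negPf nE) orbF => le.
  have /cards1P[i ->] : #|e| == 1 by rewrite eqn_leq le card_gt0.
  by exists i.
rewrite cards1; split; first by apply/negP => /(forall_inP simE); rewrite cards1.
by apply/set0Pn; exists i; rewrite inE.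
Qed.

Lemma ball_weight_mono a b E :
  (forall i, a i <= b i) -> ball_weight a E <= ball_weight b E.
Proof. by move=> le; apply: leq_sum => e _; apply: leq_prod => i _. Qed.

(** Pairs each set avoiding [i] with its extension by [i]; the two have equal weight once coordinate
    [i] has weight 1. *)
Lemma sum_sets_by (i : 'I_k) (f : {set 'I_k} -> nat) :
  \sum_e f e = \sum_(e : {set 'I_k} | i \notin e) (f e + f (i |: e)).
Proof.
rewrite (bigID (fun e : {set 'I_k} => i \in e)) /= addnC big_split /=; congr addn.
rewrite (reindex_onto (fun e : {set 'I_k} => i |: e) (fun e => e :\ i)) /=; last first.
  by move=> e; apply: setD1K.
apply: eq_bigl => e; rewrite setU11 /=; apply/eqP/idP => [<-|]; first by rewrite !inE eqxx.
exact: setU1K.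
Qed.

(** Covers stars and triangles at once: both consist of three pairwise meeting edges. *)
Lemma graph3 a (p q s : {set 'I_k}) :
    [&& #|p| == 2, #|q| == 2 & #|s| == 2] -> uniq [:: p; q; s] ->
    [&& p :&: q != set0, p :&: s != set0 & q :&: s != set0] ->
  intersecting_graph [set p; q; s] /\
  weight a [set p; q; s] =
    \prod_(i in p) a i + \prod_(i in q) a i + \prod_(i in s) a i.
Proof.
move=> /and3P[p2 q2 s2] /=; rewrite !inE negb_or -andbA andbT => /and3P[pq ps qs].
case/and3P=> mpq mps mqs.
have sim : simple_graph [set p; q; s].
  by apply/forall_inP => e; rewrite !inE -orbA => /or3P[] /eqP ->.
have n0 (e : {set 'I_k}) : #|e| == 2 -> e :&: e != set0.
  by move=> e2; rewrite setIid -card_gt0 (eqP e2).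
split.
  rewrite /intersecting_graph sim; apply/forall_inP => e; rewrite !inE -orbA => eH.
  apply/forall_inP => f; rewrite !inE -orbA => fH.
  by case/or3P: eH => /eqP ->; case/or3P: fH => /eqP ->; rewrite ?n0 // setIC.
rewrite weightE // -setUA big_setU1 /=; last by rewrite !inE negb_or pq ps.
by rewrite big_setU1 ?inE //= big_set1 addnA.
Qed.

Lemma pair_neq (i j l m : 'I_k) : i != l -> i != m -> [set i; j] != [set l; m].
Proof.
move=> il im; apply: contraTneq (set21 i j) => ->.
by rewrite !inE negb_or il im.
Qed.

Lemma prod_pair a (i j : 'I_k) : i != j -> \prod_(m in [set i; j]) a m = a i * a j.
Proof. by move=> ij; rewrite big_setU1 ?big_set1 // inE. Qed.

Lemma star_graph a (c i j l : 'I_k) : uniq [:: c; i; j; l] ->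
  let E := [set [set c; i]; [set c; j]; [set c; l]] in
  intersecting_graph E /\ weight a E = a c * (a i + a j + a l).
Proof.
rewrite /= !inE !negb_or => /and4P[/and3P[ci cj cl] /andP[ij il] jl _].
have [] := @graph3 a [set c; i] [set c; j] [set c; l].
- by rewrite !cards2 ci cj cl.
- rewrite /= !inE negb_or ![[set c; _]]setUC.
  by rewrite !pair_neq // eq_sym.
- by apply/and3P; split; apply/set0Pn; exists c; rewrite !inE eqxx.
by move=> ? ->; rewrite !prod_pair // !mulnDr.
Qed.

Lemma triangle_graph a (i j l : 'I_k) : uniq [:: i; j; l] ->
  let E := [set [set i; j]; [set i; l]; [set j; l]] in
  intersecting_graph E /\ weight a E = a i * a j + a i * a l + a j * a l.
Proof.
rewrite /= !inE !negb_or => /and3P[/andP[ij il] jl _].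
have [] := @graph3 a [set i; j] [set i; l] [set j; l].
- by rewrite !cards2 ij il jl.
- rewrite /= !inE negb_or (@pair_neq i j j l) // (@pair_neq i l j l) //.
  by rewrite setUC pair_neq // eq_sym.
- by apply/and3P; split; apply/set0Pn; [exists i | exists j | exists l];
    rewrite !inE !eqxx ?orbT.
by move=> ? ->; rewrite !prod_pair.
Qed.

End Weights.

Lemma mem_uniq4 (s : seq 'I_4) : uniq s -> size s = 4 -> s =i index_enum 'I_4.
Proof.
move=> u s4; have [] := uniq_min_size u (s2 := index_enum 'I_4) => //.
by rewrite /index_enum -enumT size_enum_ord s4.
Qed.

Lemma sum_uniq4 (f : 'I_4 -> nat) (i j k l : 'I_4) :
  uniq [:: i; j; k; l] -> \sum_m f m = f i + f j + f k + f l.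
Proof.
move=> u; rewrite (perm_big [:: i; j; k; l]) /=.
  by rewrite !big_cons big_nil addn0 !addnA.
by apply: uniq_perm => [||m]; rewrite ?index_enum_uniq // (mem_uniq4 u).
Qed.

(** * The upper bound *)

Section CrossIntersectingPairs.

Variables (K L : finType) (P Q : {set K * L}).
Hypothesis crossPQ :
  forall p q, p \in P -> q \in Q -> p.1 = q.1 \/ p.2 = q.2.

(** [Q] lies in the union of the row and the column through [p]. *)
Lemma cross_card_star p : p \in P -> #|Q| <= #|K| + #|L| - 1.
Proof.
move=> pP.
have sub : Q \subset setX [set p.1] setT :|: setX [set~ p.1] [set p.2].
  apply/subsetP => q /(crossPQ pP)[] e; rewrite !inE -e eqxx //= ?andbT ?orbN //.
apply: leq_trans (subset_leq_card sub) _; apply: leq_trans (leq_card_setU _ _) _.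
rewrite !cardsX !cards1 cardsC1 cardsT.
by have : 0 < #|K| by [apply/card_gt0P; exists p.1]; lia.
Qed.

(** Two points of [P] on a common line force [Q] into that line; two points in general position
    leave only the two opposite corners of their rectangle. *)
Lemma cross_card_max :
  1 < #|P| -> 1 < #|K| -> #|Q| <= maxn #|K| #|L|.
Proof.
case/card_gt1P => p [p' [pP p'P neq]] K2.
have [e1|n1] := eqVneq p.1 p'.1; last have [e2|n2] := eqVneq p.2 p'.2.
- have n2 : p.2 != p'.2.
    by apply: contraNneq neq; case: p p' e1 {pP p'P} => ? ? [? ?] /= -> ->.
  have sub : Q \subset setX [set p.1] setT.
    apply/subsetP => q qQ; rewrite !inE andbT.
    have [-> //|e] := crossPQ pP qQ.
    have [e'|e'] := crossPQ p'P qQ; first by rewrite e1 e'.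
    by rewrite e e' eqxx in n2.
  rewrite leq_max; apply/orP; right; apply: leq_trans (subset_leq_card sub) _.
  by rewrite cardsX cards1 cardsT mul1n.
- have sub : Q \subset setX setT [set p.2].
    apply/subsetP => q qQ; rewrite !inE /=.
    have [e|-> //] := crossPQ pP qQ.
    have [e'|e'] := crossPQ p'P qQ; last by rewrite e2 e'.
    by rewrite e e' eqxx in n1.
  rewrite leq_max; apply/orP; left; apply: leq_trans (subset_leq_card sub) _.
  by rewrite cardsX cards1 cardsT muln1.
have sub : Q \subset [set (p.1, p'.2); (p'.1, p.2)].
  apply/subsetP => -[u v] qQ; rewrite !inE !xpair_eqE /=.
  have [] := crossPQ pP qQ; have [] := crossPQ p'P qQ => /= e e'.
  - by rewrite e' e eqxx in n1.
  - by rewrite e' e !eqxx.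
  - by rewrite e' e !eqxx orbT.
  - by rewrite e' e eqxx in n2.
apply: leq_trans (subset_leq_card sub) _; rewrite cards2.
by have := leq_maxl #|K| #|L|; case: (_ != _); lia.
Qed.

End CrossIntersectingPairs.

Lemma cross_card_sum (K L : finType) (P Q : {set K * L}) :
    (forall p q, p \in P -> q \in Q -> p.1 = q.1 \/ p.2 = q.2) ->
    1 < #|K| -> P != set0 -> Q != set0 ->
  #|P| + #|Q| <= 2 * maxn #|K| #|L|.
Proof.
move=> crossPQ K2 /set0Pn[p pP] /set0Pn[q qQ].
have crossQP u v : u \in Q -> v \in P -> u.1 = v.1 \/ u.2 = v.2.
  by move=> uQ vP; have [->|->] := crossPQ _ _ vP uQ; [left | right].
(* If one set is a single point, the other lies in a cross, and the total is at most
   [#|K| + #|L|]. *)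
have [P2|P1] := ltnP 1 #|P|; last by have := cross_card_star crossPQ pP; lia.
have [Q2|Q1] := ltnP 1 #|Q|; last by have := cross_card_star crossQP qQ; lia.
have := cross_card_max crossPQ P2 K2; have := cross_card_max crossQP Q2 K2; lia.
Qed.

Section FourParts.

Variables (X : 'I_4 -> finType) (x0 : edge X) (F : {set edge X}).
Hypotheses (X_gt1 : forall i, 1 < #|X i|) (agF : pairwise_agree F)
  (ncF : no_common_vertex F).

(* The slices are indexed by whether [x i] and [x j] are base values: opposite
   slices project to cross-intersecting sets, slices differing only in [j] to
   disjoint ones, and no vertex being common makes two adjacent slices never both
   empty. *)
Lemma card_two_split (i j k l : 'I_4) (ci : X i) (cj : X j) :
    uniq [:: i; j; k; l] ->
    (forall x, x \in F -> x i = x0 i \/ x i = ci) -> split_at x0 F cj ->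
  #|F| <= maxn (4 * maxn #|X k| #|X l|) (#|X k| * #|X l| + #|X k| + #|X l| - 1).
Proof.
move=> uniq_ijkl spi spj.
have [ij kj lj] : [/\ i != j, (k == j) = false & (l == j) = false].
  move: uniq_ijkl; rewrite /= !inE !negb_or -!(eq_sym j).
  by case/and4P=> /and3P[ij _ _] /andP[/negPf jk /negPf jl] _ _.
have in4 m : m \in [:: i; j; k; l] by rewrite mem_uniq4 // mem_index_enum.
have spj' x : x \in F -> x j = x0 j \/ x j = cj.
  by move=> /spj[|[]]; [left | right].
pose proj (x : edge X) := (x k, x l).
pose slice b b' := [set x in F | ((x i == x0 i) == b) && ((x j == x0 j) == b')].
pose Q b b' := proj @: slice b b'.
(* With only two possible values, being at the base value or not determines the coordinate. *)
have slice_eq (m : 'I_4) (c : X m) (x y : edge X) (b : bool) :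
    x m = x0 m \/ x m = c -> y m = x0 m \/ y m = c ->
    (x m == x0 m) == b -> (y m == x0 m) == b -> x m = y m.
  by case=> -> [] -> // /eqP <-; rewrite eqxx ?(eq_sym true) ?eqb_id => /eqP.
have proj_inj b b' : {in slice b b' &, injective proj}.
  move=> x y; rewrite !inE => /and3P[xF xi xj] /and3P[yF yi yj] [ek el].
  apply/ffunP => m; have := in4 m; rewrite !inE => /or4P[] /eqP -> //.
  - exact: slice_eq (spi _ xF) (spi _ yF) xi yi.
  - exact: slice_eq (spj' _ xF) (spj' _ yF) xj yj.
have cardQ b b' : #|Q b b'| = #|slice b b'| by exact/card_in_imset/proj_inj.
have cardF : #|F| = #|Q true true| + #|Q true false| + #|Q false true| + #|Q false false|.
  rewrite !cardQ -(cardsID [set x : edge X | x i == x0 i] F).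
  rewrite -(cardsID [set x : edge X | x j == x0 j] (F :&: _)).
  rewrite -(cardsID [set x : edge X | x j == x0 j] (F :\: _)) addnA.
  by do !congr addn; apply: eq_card => x; rewrite !inE;
    case: (x \in F) (x i == x0 i) (x j == x0 j) => [] [] [].
have crossQ b b' p q : p \in Q b b' -> q \in Q (~~ b) (~~ b') ->
    p.1 = q.1 \/ p.2 = q.2.
  move=> /imsetP[x]; rewrite inE => /and3P[xF /eqP xi /eqP xj] ->.
  move=> /imsetP[y]; rewrite inE => /and3P[yF /eqP yi /eqP yj] ->.
  have [m] := agF xF yF; have := in4 m; rewrite !inE => /or4P[] /eqP -> /= e; auto.
  - by move: yi; rewrite -e xi; case: (b).
  - by move: yj; rewrite -e xj; case: (b').
have disjQ b : #|Q b true| + #|Q b false| <= #|X k| * #|X l|.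
  rewrite -card_prod -cardsT; apply: leq_trans (subset_leq_card (subsetT (Q b true :|: Q b false))).
  rewrite cardsU; suff -> : Q b true :&: Q b false = set0 by rewrite cards0 subn0.
  apply/setP => p; rewrite [RHS]inE; apply/negP => /setIP[] /imsetP[x xb ->].
  move/imsetP => [y yb [ek el]]; move: xb yb; rewrite !inE.
  move=> /and3P[xF xi /eqP xj] /and3P[yF yi /eqP yj].
  case: (spj y yF) => [e|[_]]; first by rewrite e eqxx in yj.
  move=> /negP; apply.
  suff -> : reset x0 [set j] y = x by [].
  apply/ffunP => m; rewrite resetE inE; have := in4 m.
  rewrite !inE => /or4P[] /eqP ->; rewrite ?(negPf ij) ?eqxx ?kj ?lj ?ek ?el //.
  - exact: slice_eq (spi _ yF) (spi _ xF) yi xi.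
  - by apply/esym/eqP; rewrite xj.
have Q_neq0 b b' x :
    x \in F -> (x i == x0 i) = b -> (x j == x0 j) = b' -> Q b b' != set0.
  move=> xF xi xj; apply/set0Pn; exists (proj x); apply: imset_f.
  by rewrite inE xF xi xj !eqxx.
have Qi b : (Q b true != set0) || (Q b false != set0).
  have [x xF xi] : exists2 x, x \in F & (x i == x0 i) = b.
    case: b; last by have [x xF /negPf] := ncF (x0 i); exists x.
    have [x xF n] := ncF ci; exists x => //; apply/eqP.
    by case: (spi _ xF) => // e; rewrite e eqxx in n.
  case xj: (x j == x0 j); first by rewrite (Q_neq0 _ _ _ xF xi xj).
  by rewrite (Q_neq0 _ _ _ xF xi xj) orbT.
have Qj b' : (Q true b' != set0) || (Q false b' != set0).
  have [x xF xj] : exists2 x, x \in F & (x j == x0 j) = b'.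
    case: b'; last by have [x xF /negPf] := ncF (x0 j); exists x.
    have [x xF n] := ncF cj; exists x => //; apply/eqP.
    by case: (spj' _ xF) => // e; rewrite e eqxx in n.
  case xi: (x i == x0 i); first by rewrite (Q_neq0 _ _ _ xF xi xj).
  by rewrite (Q_neq0 _ _ _ xF xi xj) orbT.
(* The neighbour across [i] is nonempty, so the slice opposite to it lies in a cross. The remaining
   two slices differ only in [j] and share one grid. *)
have emptyQ b b' : Q b b' = set0 ->
    #|F| <= #|X k| * #|X l| + #|X k| + #|X l| - 1.
  move=> Q0.
  have /set0Pn[p pQ] : Q (~~ b) b' != set0.
    by have := Qj b'; case: b Q0 => /= ->; rewrite eqxx ?orbF.
  have := @cross_card_star _ _ _ _ (@crossQ (~~ b) b') p pQ; rewrite negbK.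
  have := disjQ (~~ b); rewrite cardF; move: (X_gt1 k).
  have arith (u v s t w : nat) :
      1 < u -> s + t <= u * v -> w <= u + v - 1 -> w + s + t <= u * v + u + v - 1.
    by lia.
  case: b b' Q0 {pQ} => [] [] /= ->; rewrite cards0 ?add0n ?addn0 => X2 le1 le2.
  - exact: arith.
  - exact: arith.
  - by rewrite addnC addnA; apply: arith.
  - by rewrite addnC addnA; apply: arith.
have [/eqP /emptyQ|tt] := boolP (Q true true == set0); first by lia.
have [/eqP /emptyQ|tf] := boolP (Q true false == set0); first by lia.
have [/eqP /emptyQ|ft] := boolP (Q false true == set0); first by lia.
have [/eqP /emptyQ|ff] := boolP (Q false false == set0); first by lia.
(* All slices are nonempty, so each of the two opposite pairs obeys [cross_card_sum]. *)
have arith (p q s t w : nat) : p + t <= 2 * w -> q + s <= 2 * w -> p + q + s + t <= 4 * w.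
  by lia.
rewrite cardF leq_max; apply/orP; left; apply: arith.
  exact: cross_card_sum (@crossQ true true) (X_gt1 k) tt ff.
exact: cross_card_sum (@crossQ true false) (X_gt1 k) tf ft.
Qed.

Local Notation a := (fun i => #|X i|.-1).

Lemma card_le_supp_weights (B : forall i, {set X i}) :
    x0 \in setXn B -> F \subset setXn B ->
  #|F| <= \sum_(S in supp x0 @: F) \prod_(i in S) #|B i|.-1.
Proof.
move=> x0B FB; rewrite -sum1_card (partition_big_imset (supp x0)) /=.
apply: leq_sum => S _; rewrite sum1dep_card -(card_supp_fibre S x0B).
apply/subset_leq_card/subsetP => x; rewrite inE => /andP[xF eS]; rewrite inE eS.
by rewrite andbT (subsetP FB).
Qed.

Lemma supports_cover i : exists2 S, S \in supp x0 @: F & i \in S.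
Proof.
have [x xF n] := ncF (x0 i).
by exists (supp x0 x); rewrite ?imset_f // inE.
Qed.

Lemma disjoint_pairsE (e f : {set 'I_4}) :
  #|e| = 2 -> #|f| = 2 -> e :&: f = set0 -> f = ~: e.
Proof.
move=> e2 f2 ef; apply/eqP; rewrite eqEcard subsetC -disjoints_subset.
by rewrite -setI_eq0 ef eqxx -(leq_add2l #|e|) cardsC card_ord e2 f2.
Qed.

(** The supports of size two form the graph. A support of size at least three misses at most one
    coordinate, and some support contains that one, so the two would cover [4]. *)
Lemma card_stable :
  stable x0 set0 F -> exists2 G, intersecting_graph G & #|F| <= ball_weight a G.
Proof.
move=> stF; pose SF := supp x0 @: F.
have union S T : S \in SF -> T \in SF -> S :|: T != setT.
  move=> /imsetP[x xF ->] /imsetP[y yF ->].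
  by apply: (stable_agree stF) => // i; rewrite inE.
exists [set S in SF | #|S| == 2].
  apply/andP; split; first by apply/forall_inP => e; rewrite inE => /andP[].
  apply/forall_inP => e; rewrite inE => /andP[eSF /eqP e2].
  apply/forall_inP => f; rewrite inE => /andP[fSF /eqP f2].
  apply: contra (union _ _ eSF fSF) => /eqP ef.
  by rewrite (disjoint_pairsE e2 f2 ef) setUCr.
have FT : F \subset setXn (fun i => [set: X i]).
  by apply/subsetP => x _; apply/setXnP => i; rewrite inE.
have x0T : x0 \in setXn (fun i => [set: X i]) by apply/setXnP => i; rewrite inE.
apply: leq_trans (card_le_supp_weights x0T FT) _.
rewrite (eq_bigr (fun S : {set 'I_4} => \prod_(i in S) #|X i|.-1)); last first.
  by move=> S _; apply: eq_bigr => i _; rewrite cardsT.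
rewrite /ball_weight [leqLHS]big_mkcond [leqRHS]big_mkcond leq_sum //= => S _.
case: ifP => // SSF; rewrite inE SSF /=.
case: ifP => // /negbT; rewrite negb_or -ltnNge => /andP[S1 S2].
have : #|~: S| <= 1.
  rewrite -(leq_add2l #|S|) cardsC card_ord addn1.
  by case: #|S| S1 S2 => [|[|[|]]].
case: (set_0Vmem (~: S)) => [S0|[i iS] /card_le1_eqP Si].
  by have := union _ _ SSF SSF; rewrite setUid -(setCK S) S0 setC0 eqxx.
have [T TSF iT] := supports_cover i; case/negP: (union _ _ SSF TSF).
apply/eqP/setP => j; rewrite !inE; case: (boolP (j \in S)) => //= jS.
by rewrite (Si i j iS) // inE jS.
Qed.

Lemma card_stable1 (i : 'I_4) (x1 : edge X) :
    stable x0 [set i] F -> (forall x, x \in F -> x i = x0 i \/ x i = x1 i) ->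
  exists2 G, intersecting_graph G & #|F| <= ball_weight a G.
Proof.
move=> stF spi; pose SF := supp x0 @: F.
have union S T : S \in SF -> T \in SF -> i \in S -> i \notin T -> S :|: T != setT.
  move=> /imsetP[x xF ->] /imsetP[y yF ->]; rewrite !inE => xi yi.
  apply: (stable_agree stF) => // _ /set1P ->.
  by apply: contraNneq xi => ->; case: eqP yi.
have cover j : exists2 S, S \in SF & j \in S by apply: supports_cover.
have [S0 S0F iS0] : exists2 S, S \in SF & i \notin S.
  have [x xF n] := ncF (x1 i); exists (supp x0 x); rewrite ?imset_f // inE negbK.
  by case: (spi _ xF) => e; [apply/eqP | rewrite e eqxx in n].
have x10 : x0 i != x1 i.
  have [x xF n] := ncF (x0 i).
  by case: (spi _ xF) => e; [rewrite e eqxx in n | rewrite -e eq_sym].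
pose B j := if j == i then [set x0 j; x1 j] else [set: X j].
have x0B : x0 \in setXn B.
  by apply/setXnP => j; rewrite /B; case: ifP; rewrite !inE ?eqxx.
have FB : F \subset setXn B.
  apply/subsetP => x xF; apply/setXnP => j; rewrite /B.
  case: eqP => [->|]; rewrite !inE //.
  by case: (spi _ xF) => ->; rewrite eqxx ?orbT.
pose b j := #|B j|.-1.
have bi : b i = 1 by rewrite /b /B eqxx cards2 x10.
have ba j : b j <= a j.
  rewrite /b /B; case: eqP => [->|_]; last by rewrite cardsT.
  by rewrite cards2 x10; case: #|X i| (X_gt1 i) => [|[]].
pose P (T : {set 'I_4}) := (T \in SF) || (i |: T \in SF).
(* With [b i = 1] the supports [T] and [i |: T] have the same weight. A pair [T]
   avoiding [i] is an edge of [G] if one of them occurs; otherwise the room left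
   by [T] goes to the edge [~: T] at [i], which pays for both [{k}] and [{i, k}]
   occurring, where [~: T] is [{i, k}]. *)
pose G := [set T : {set 'I_4} | (#|T| == 2) && (if i \in T then ~~ P (~: T) else P T)].
exists G.
  apply/andP; split; first by apply/forall_inP => e; rewrite inE => /andP[].
  apply/forall_inP => e eG; apply/forall_inP => f fG; apply/negP => /eqP ef.
  move: eG fG; rewrite !inE => /andP[/eqP e2 eP] /andP[/eqP f2].
  move: eP; rewrite (disjoint_pairsE e2 f2 ef) inE setCK.
  by case: (i \in e) => /= [/negPf ->|->].
apply: leq_trans (card_le_supp_weights x0B FB) _.
apply: leq_trans (ball_weight_mono G ba).
rewrite /ball_weight [leqLHS]big_mkcond [leqRHS]big_mkcond /=.
rewrite !(sum_sets_by i) leq_sum // => T iT.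
have -> : \prod_(j in i |: T) b j = \prod_(j in T) b j.
  by rewrite big_setU1 //= bi mul1n.
rewrite -/(b _).
have mulE (c : bool) m : (if c then m else 0) = c * m by case: c; rewrite ?mul1n.
(* The common weight of [T] and [i |: T] cancels; what remains compares how many of the two occur
   with how many the ball admits. *)
rewrite !mulE -!mulnDl leq_mul2r; apply/orP; right.
have card_iT : #|i |: T| = #|T|.+1 by rewrite cardsU1 iT.
have full S U V : S \in SF -> U \in SF -> i \in S -> i \notin U ->
    (forall j, j \notin S -> j \in U) -> V.
  move=> SS US iS iU sub; case/negP: (union _ _ SS US iS iU).
  by apply/eqP/setP => j; rewrite !inE; case: (boolP (j \in S)) => //= /sub.
have iiT : i \in i |: T := setU11 _ _.
(* For larger [T], the set [i |: T] misses at most one coordinate [k]. A support through [k]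
   completes [T] if it contains [i], and [i |: T] if not. *)
have both : T \in SF -> i |: T \in SF -> #|T| <= 1.
  move=> TS iTS; rewrite leqNgt; apply/negP => T2.
  have : #|~: (i |: T)| <= 1.
    rewrite -(leq_add2l #|i |: T|) cardsC card_ord card_iT addn1.
    by case: #|T| T2 => [|[]].
  have [C0|[k kC] /card_le1_eqP Ck] := set_0Vmem (~: (i |: T)).
    by apply: (full _ _ _ iTS S0F) => // j; rewrite -in_setC C0 inE.
  have onlyk j : j \notin i |: T -> j = k by rewrite -in_setC => jC; apply: Ck.
  have [S SS kS] := cover k; case: (boolP (i \in S)) => iS.
    apply: (full _ _ _ SS TS) => // j; apply: contraNT => jT.
    have [->//|ji] := eqVneq j i.
    by rewrite (onlyk j) // !inE negb_or ji.
  by apply: (full _ _ _ iTS SS) => // j /onlyk ->.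
(* For larger [T], the set [i |: T] is all of [4]: [T] is completed by a support through [i], and
   [i |: T] by [S0]. *)
have excl : P T -> #|T| <= 2.
  move=> PT; rewrite leqNgt; apply/negP => T3.
  have eT : i |: T = setT.
    by apply/eqP; rewrite eqEcard subsetT cardsT card_ord card_iT.
  case/orP: PT => [TS|iTS]; last by apply: (full _ _ _ iTS S0F) => // j; rewrite eT inE.
  have [S SS iS] := cover i; apply: (full _ _ _ SS TS) => // j jS.
  have : j \in i |: T by rewrite eT.
  by rewrite !inE; case: eqP => // ji; rewrite -ji (negPf jS) in iS.
rewrite card_iT !inE card_iT (negPf iT) eqxx /=.
(* Size 0: the ball admits both sets. Size 1: it admits [T], and also [i |: T] if both occur. Size
   2: at most one occurs, and then [T] is in [G]. Size 3: none occurs. *)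
case: #|T| both excl => [|[|[|m]]] both excl /=.
- by do 2!case: (_ \in SF).
- rewrite /P; case: (boolP (T \in SF)) => TS; last by case: (_ \in SF).
  case: (boolP (i |: T \in SF)) => iTS; last by rewrite leq_addr.
  suff /norP[/negPf -> /negPf ->] : ~~ P (~: (i |: T)) by [].
  apply/negP => /orP[US|US].
    by apply: (full _ _ _ iTS US) => [||j]; rewrite ?inE ?eqxx.
  apply: (full _ _ _ US TS) => [||j] //; rewrite ?setU11 //.
  by rewrite !inE; case: eqP => //= _; rewrite negbK.
- by rewrite /P addn0; move: both; do 2!case: (_ \in SF) => //; move=> /(_ isT isT).
- by move: excl; rewrite /P; do 2!case: (_ \in SF) => //; move=> /(_ isT).
Qed.

End FourParts.

Lemma two_others (i j : 'I_4) : i != j -> exists k l, uniq [:: i; j; k; l].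
Proof.
move=> ij; have /cards2P[k [l [kl e]]] : #|~: [set i; j]| == 2.
  by rewrite -(eqn_add2l #|[set i; j]|) cardsC card_ord cards2 ij.
have : k \in ~: [set i; j] by rewrite e !inE eqxx.
have : l \in ~: [set i; j] by rewrite e !inE eqxx orbT.
rewrite !inE !negb_or => /andP[li lj] /andP[ki kj]; exists k, l.
rewrite /= !inE !negb_or ij kl (eq_sym i k) (eq_sym i l) (eq_sym j k) (eq_sym j l).
by rewrite ki li kj lj.
Qed.

Lemma card_le_ball_weight (X : 'I_4 -> finType) (F : {set edge X}) :
    (forall i, 1 < #|X i|) -> pairwise_agree F -> no_common_vertex F ->
  exists2 G, intersecting_graph G & #|F| <= ball_weight (fun i => #|X i|.-1) G.
Proof.
move=> X_gt1 agF ncF.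
have [c0 _] : exists c : X ord0, c \in predT by apply/card_gt0P/ltnW/X_gt1.
have [x0 _ _] := ncF ord0 c0.
have x0T : x0 \in setXn (fun i => [set: X i]) by apply/setXnP => i; rewrite inE.
have FT : F \subset setXn (fun i => [set: X i]).
  by apply/subsetP => x _; apply/setXnP => i; rewrite inE.
have [F1 [<- _ agF1 ncF1 [stF1|[i [_ [ci spi]]]]]] := compress set0 x0T FT agF ncF.
  exact: card_stable stF1.
have [x1 x1F x1i] := ncF1 i (x0 i).
(* The second value is renamed as a coordinate of an edge: [x1] leaves the base value at [i], so
   [x1 i] is [ci]. *)
have {}spi x : x \in F1 -> x i = x0 i \/ x i = x1 i.
  move=> /spi[->|[-> _]]; first by left.
  by right; case: (spi x1 x1F) => [e|[-> //]]; rewrite e eqxx in x1i.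
pose B j := if j == i then [set x0 j; x1 j] else [set: X j].
have x0B : x0 \in setXn B.
  by apply/setXnP => j; rewrite /B; case: ifP; rewrite !inE ?eqxx.
have F1B : F1 \subset setXn B.
  apply/subsetP => x xF; apply/setXnP => j; rewrite /B.
  case: eqP => [->|]; rewrite !inE //.
  by case: (spi _ xF) => ->; rewrite eqxx ?orbT.
have [F2 [<- F2B agF2 ncF2 alt]] := compress [set i] x0B F1B agF1 ncF1.
have {}spi x : x \in F2 -> x i = x0 i \/ x i = x1 i.
  move=> /(subsetP F2B)/setXnP/(_ i); rewrite /B eqxx !inE.
  by case/orP => /eqP; [left | right].
case: alt => [stF2|[j [ji [cj spj]]]]; first exact: card_stable1 stF2 spi.
have ij : i != j by rewrite inE eq_sym in ji.
have [k [l uniq_ijkl]] := two_others ij.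
pose a m := #|X m|.-1; rewrite -/a.
have bound := card_two_split X_gt1 agF2 ncF2 uniq_ijkl spi spj.
suff [G intG le] : exists2 G, intersecting_graph G &
    maxn (4 * maxn #|X k| #|X l|) (#|X k| * #|X l| + #|X k| + #|X l| - 1)
      <= 1 + (a i + a j + a k + a l) + weight a G.
  exists G => //; rewrite ball_weightE; last by case/andP: intG.
  by rewrite (sum_uniq4 _ uniq_ijkl) (leq_trans bound).
have a_gt0 m : 0 < a m by rewrite /a; case: #|X m| (X_gt1 m) => [|[]].
have cardX m : #|X m| = (a m).+1 by rewrite /a prednK // ltnW.
(* The bound [4 * maxn] is dominated by the star centred at the larger of the parts [k], [l], and
   the other bound by the triangle on [j], [k], [l]. *)
have arith ai aj ak al : 0 < ai -> 0 < aj -> 0 < ak -> 0 < al ->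
  [/\ 4 * ak.+1 <= 1 + (ai + aj + ak + al) + ak * (ai + aj + al),
      4 * al.+1 <= 1 + (ai + aj + ak + al) + al * (ai + aj + ak)
    & ak.+1 * al.+1 + ak.+1 + al.+1 - 1 <=
        1 + (ai + aj + ak + al) + (aj * ak + aj * al + ak * al)].
  by move=> *; split; nia.
have [le_k le_l le_jkl] := arith _ _ _ _ (a_gt0 i) (a_gt0 j) (a_gt0 k) (a_gt0 l).
have uniq_k : uniq [:: k; i; j; l] by exact: etrans (uniq_catCA [:: k] [:: i; j] [:: l]) uniq_ijkl.
have uniq_l : uniq [:: l; i; j; k] by exact: etrans (uniq_catC [:: l] [:: i; j; k]) uniq_ijkl.
have uniq_jkl : uniq [:: j; k; l] by case/andP: uniq_ijkl.
have [intk wk] := star_graph a uniq_k.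
have [intl wl] := star_graph a uniq_l.
have [intt wt] := triangle_graph a uniq_jkl.
have [le_tri|] := leqP (4 * maxn #|X k| #|X l|) (#|X k| * #|X l| + #|X k| + #|X l| - 1).
  by eexists; [exact: intt | rewrite wt !cardX].
move=> _; have [le_lk|lt_kl] := leqP #|X l| #|X k|.
  by eexists; [exact: intk | rewrite wk cardX].
by eexists; [exact: intl | rewrite wl cardX].
Qed.

(** * The extremal families *)

Section SupportBall.

Variables (X : 'I_4 -> finType) (x0 : edge X) (G : {set {set 'I_4}}).
Hypotheses (X_gt1 : forall i, 1 < #|X i|) (intG : intersecting_graph G).

Definition support_ball : {set edge X} :=
  [set x | (#|supp x0 x| <= 1) || (supp x0 x \in G)].

Lemma card_support_ball : #|support_ball| = ball_weight (fun i => #|X i|.-1) G.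
Proof.
have x0T : x0 \in setXn (fun i => [set: X i]) by apply/setXnP => i; rewrite inE.
rewrite -sum1_card (partition_big (supp x0) (fun e => (#|e| <= 1) || (e \in G))) /=.
  apply: eq_bigr => S PS; rewrite sum1dep_card.
  under [RHS]eq_bigr => i _ do rewrite -cardsT.
  rewrite -(card_supp_fibre S x0T); apply: eq_card => x.
  rewrite [in RHS]inE in_setXn [LHS]inE /support_ball inE.
  rewrite (_ : [forall i, _]) ?andTb; last by apply/forallP => i; rewrite inE.
  by case: eqP => [->|]; rewrite ?PS ?andbF.
by move=> x; rewrite inE.
Qed.

(** Two supports of size at most two cover [4] only if they are disjoint edges of [G]; any
    coordinate outside both has the base value in both edges. *)
Lemma support_ball_agree : pairwise_agree support_ball.
Proof.
case/andP: intG => /forall_inP sim /forall_inP int.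
move=> x y; rewrite !inE => xB yB.
suff : supp x0 x :|: supp x0 y != setT.
  rewrite -subTset => /subsetPn[i _]; rewrite !inE negb_or !negbK => /andP[/eqP ex /eqP ey].
  by exists i; rewrite ex ey.
apply/eqP => /(congr1 (fun S : {set 'I_4} => #|S|)); rewrite cardsT card_ord cardsU.
case/orP: xB => [x1|xG]; case/orP: yB => [y1|yG].
- by lia.
- by have /eqP := sim _ yG; lia.
- by have /eqP := sim _ xG; lia.
have /eqP := sim _ xG; have /eqP := sim _ yG => -> ->.
by have /forall_inP/(_ _ yG) := int _ xG; rewrite -card_gt0; case: #|_ :&: _|; lia.
Qed.

(** A non-base vertex is missed by [x0], a base vertex at [i] by an edge with support [[set i]]. *)
Lemma support_ball_no_common : no_common_vertex support_ball.
Proof.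
move=> i c; have [->|nc] := eqVneq c (x0 i); last first.
  exists x0; last by rewrite eq_sym.
  rewrite inE (_ : supp x0 x0 = set0) ?cards0 //.
  by apply/setP => j; rewrite !inE eqxx.
have x0T : x0 \in setXn (fun i => [set: X i]) by apply/setXnP => j; rewrite inE.
have : 0 < #|[set x in setXn (fun i => [set: X i]) | supp x0 x == [set i]]|.
  by rewrite (card_supp_fibre _ x0T) big_set1 cardsT; case: #|X i| (X_gt1 i) => [|[]].
case/card_gt0P => x; rewrite inE => /andP[_ /eqP e]; exists x; first by rewrite inE e cards1.
by have := set11 i; rewrite -e inE.
Qed.

End SupportBall.

(** * Maximum weight of an intersecting graph on [4] *)

Lemma weight4 (a : 'I_4 -> nat) (G : {set {set 'I_4}}) :
  weight a G =
    (([set i1; i2] \in G) * (a i1 * a i2) + ([set i3; i4] \in G) * (a i3 * a i4))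
    + (([set i1; i3] \in G) * (a i1 * a i3) + ([set i2; i4] \in G) * (a i2 * a i4))
    + (([set i1; i4] \in G) * (a i1 * a i4) + ([set i2; i3] \in G) * (a i2 * a i3)).
Proof.
have u : uniq [:: i1; i2; i3; i4] by [].
have mulE (c : bool) m : (if c then m else 0) = c * m by case: c; rewrite ?mul1n.
rewrite /weight; under eq_bigr => i _ do rewrite big_mkcond (sum_uniq4 _ u).
by rewrite (sum_uniq4 _ u) /= !mulE; lia.
Qed.

(** The six pairs form three complementary couples, and [G] takes at most one from each. The
    ordering favours 12 over 34 and 13 over 24; choosing 14 or 23 yields the star or the
    triangle. *)
Lemma weight4_le (a : 'I_4 -> nat) (G : {set {set 'I_4}}) :
    a i2 <= a i1 -> a i3 <= a i2 -> a i4 <= a i3 -> intersecting_graph G ->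
  weight a G <= maxn (weight a star1) (weight a triangle123).
Proof.
move=> a21 a32 a43 /andP[_ /forall_inP int].
have pair_excl (e f : {set 'I_4}) (m n p : nat) : e :&: f = set0 -> m <= p -> n <= p ->
    (e \in G) * m + (f \in G) * n <= p.
  move=> ef mp np; case: (boolP (e \in G)) => [eG|_]; last by case: (f \in G); lia.
  have /forall_inP/(_ f) := int e eG; rewrite ef eqxx.
  by case: (f \in G) => [/(_ isT)|] //; lia.
have [_ ->] := @star_graph 4 a i1 i2 i3 i4 isT.
have [_ ->] := @triangle_graph 4 a i1 i2 i3 isT.
have disj (i j k l : 'I_4) : uniq [:: i; j; k; l] -> [set i; j] :&: [set k; l] = set0.
  rewrite /= !inE !negb_or => /and4P[/and3P[_ ik il] /andP[jk jl] _ _].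
  apply/setP => m; rewrite !inE; apply/negP => /andP[/orP[]/eqP-> /orP[]/eqP e];
    by move: ik il jk jl; rewrite e eqxx.
have h1 := @pair_excl [set i1; i2] [set i3; i4] (a i1 * a i2) (a i3 * a i4) (a i1 * a i2)
  (disj i1 i2 i3 i4 isT) (leqnn _).
have h2 := @pair_excl [set i1; i3] [set i2; i4] (a i1 * a i3) (a i2 * a i4) (a i1 * a i3)
  (disj i1 i3 i2 i4 isT) (leqnn _).
have h3 := @pair_excl [set i1; i4] [set i2; i3] (a i1 * a i4) (a i2 * a i3)
  (maxn (a i1 * a i4) (a i2 * a i3)) (disj i1 i4 i2 i3 isT) (leq_maxl _ _) (leq_maxr _ _).
have {}h1 := h1 (leq_mul (leq_trans a32 a21) (leq_trans a43 a32)).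
have {}h2 := h2 (leq_mul a21 a43).
rewrite weight4 (leq_trans (leq_add (leq_add h1 h2) h3)) //.
by rewrite addn_maxr !mulnDr geq_max !leq_max leqnn /= leqnn orbT.
Qed.

Theorem theorem4p1 (n : 'I_4 -> nat) (X : 'I_4 -> finType)
    (cardX : forall i, #|X i| = n i) (n_ge2 : forall i, 2 <= n i)
    (a : 'I_4 -> nat) (aE : forall i, a i = n i - 1) :
  m0 X 1 = 1 + \sum_(i < 4) a i
           + \max_(G : {set {set 'I_4}} | intersecting_graph G) weight a G
  /\ ([/\ n i2 <= n i1, n i3 <= n i2 & n i4 <= n i3] ->
      m0 X 1 = maxn (n i1 * (n i2 + n i3 + n i4 - 2))
                    (n i1 * n i2 * n i3
                     - (n i1 - 1) * (n i2 - 1) * (n i3 - 1) + n i4 - 1)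
      /\ (max_attained_at a star1 \/ max_attained_at a triangle123)).
Proof.
have X_gt1 i : 1 < #|X i| by rewrite cardX.
have aX i : #|X i|.-1 = a i by rewrite cardX aE subn1.
have ball_a G : intersecting_graph G ->
    ball_weight (fun i => #|X i|.-1) G = 1 + \sum_(i < 4) a i + weight a G.
  case/andP=> simG _; rewrite -ball_weightE //.
  by apply: eq_bigr => e _; apply: eq_bigr => i _.
have X_gt0 i : 0 < #|X i| := ltnW (X_gt1 i).
have m0E : m0 X 1 = 1 + \sum_(i < 4) a i
    + \max_(G : {set {set 'I_4}} | intersecting_graph G) weight a G.
  apply/eqP; rewrite eqn_leq; apply/andP; split.
    apply/bigmax_leqP => F /andP[nuF tauF].
    have agF : pairwise_agree F by apply/nu_le1P.
    have ncF : no_common_vertex F by apply/tau_gt1P.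
    have [G intG le] := card_le_ball_weight X_gt1 agF ncF.
    by rewrite (leq_trans le) // ball_a // leq_add2l leq_bigmax_cond.
  (* A maximizing graph is fixed, so that its support ball attains the bound. *)
  have [G intG ->] : {G | intersecting_graph G &
      \max_(G | intersecting_graph G) weight a G = weight a G}.
    apply: eq_bigmax_cond; apply/card_gt0P; exists star1.
    by have [] := @star_graph 4 a i1 i2 i3 i4 isT.
  have x0 : edge X := finfun (fun i => enum_val (Ordinal (X_gt0 i))).
  rewrite -ball_a // -(card_support_ball x0); apply: leq_bigmax_cond.
  apply/andP; split.
    by apply/nu_le1P => //; apply: support_ball_agree.
  by apply/tau_gt1P => //; apply: support_ball_no_common.
split=> // -[n21 n32 n43].
have a21 : a i2 <= a i1 by rewrite !aE leq_sub2r.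
have a32 : a i3 <= a i2 by rewrite !aE leq_sub2r.
have a43 : a i4 <= a i3 by rewrite !aE leq_sub2r.
have [intS wS] := @star_graph 4 a i1 i2 i3 i4 isT.
have [intT wT] := @triangle_graph 4 a i1 i2 i3 isT.
have maxE : \max_(G : {set {set 'I_4}} | intersecting_graph G) weight a G =
    maxn (weight a star1) (weight a triangle123).
  apply/eqP; rewrite eqn_leq geq_max !leq_bigmax_cond // !andbT.
  by apply/bigmax_leqP => G; apply: weight4_le.
split; last first.
  case: (leqP (weight a triangle123) (weight a star1)) => [le|/ltnW le].
    by left; split; rewrite // maxE (maxn_idPl le).
  by right; split; rewrite // maxE (maxn_idPr le).
rewrite m0E maxE addn_maxr wS wT (@sum_uniq4 _ i1 i2 i3 i4) //.
have nE i : n i = (a i).+1 by rewrite aE subn1 prednK // ltnW.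
rewrite !nE !subn1 /=; congr maxn; first by lia.
(* The product is split off as a summand so that the truncated subtraction cancels exactly. *)
have -> : (a i1).+1 * (a i2).+1 * (a i3).+1 = a i1 * a i2 * a i3 +
   (1 + a i1 + a i2 + a i3 + (a i1 * a i2 + a i1 * a i3 + a i2 * a i3)) by lia.
by rewrite addKn; lia.
Qed.
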